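(* For every $k\ge 2$ there is a homomorphism $p_k:M_k\to M_{k-1}$ satisfying $p_k\circ\pi_k=\pi_{k-1}$.
   Context: Let $F_n$ be a free group with finite basis $X$. Graphs are in the sense of Serre (edges come with a fixed-point-free inversion $e\mapsto\bar e$). An $X$-labeled graph has edges labeled by $X\cup X^{-1}$ so that $\bar e$ carries the inverse label; morphisms preserve labels; it is folded if distinct edges with the same initial vertex have distinct labels. A u-word (unoriented word) is a folded labeled graph homeomorphic to a compact line segment, up to isomorphism (equivalently, a reduced word $u\neq1$ up to inversion, $\overline u=\overline{u^{-1}}$); its length is its number of unoriented edges. A cyclic word is a folded labeled graph homeomorphic to a circle, up to isomorphism (equivalently, a nontrivial cyclically reduced word up to cyclic permutation and inversion). $\mathrm{Hom}(u,w)$ is the set of labeled graph morphisms $u\to w$ (not necessarily injective). $W_k$ is the set of u-words of length $k$, $M_k$ is the free $\mathbb Z$-module on $W_k$, $C$ is the set of cyclic words and $\mathbb Z[C]$ is the free $\mathbb Z$-module on $C$. The homomorphism $\pi_k:\mathbb Z[C]\to M_k$ is defined by $\pi_k(w)=\sum_{u\in W_k}|\mathrm{Hom}(u,w)|\,u$ for $w\in C$. *)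

(* Defs.v *)
From HB Require Import structures.
From mathcomp Require Import all_boot all_order all_algebra.
From mathcomp Require Import generic_quotient.
From mathcomp.multinomials Require Import freeg.

Set Implicit Arguments.
Unset Strict Implicit.
Unset Printing Implicit Defensive.

Import GRing.Theory.
Local Open Scope ring_scope.
Local Open Scope quotient_scope.

Record graph := Graph {
  vertex : finType;
  edge : finType;
  origin : edge -> vertex;
  einv : edge -> edge;
  einvK : involutive einv;
  einv_neq : forall e, einv e != e }.

(* The terminal vertex of an edge e is origin (einv e), so a map commuting
   with origin and einv also commutes with terminal vertices. *)
Definition gmap (G H : graph) : finType :=
  ({ffun vertex G -> vertex H} * {ffun edge G -> edge H})%type.

Definition is_gmorph (G H : graph) (f : gmap G H) : bool :=
  [forall e, (origin (f.2 e) == f.1 (origin e))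
          && (einv (f.2 e) == f.2 (einv e))].

Definition gid (G : graph) : gmap G G := ([ffun v => v], [ffun e => e]).

Definition gcomp (G H K : graph) (g : gmap H K) (f : gmap G H) : gmap G K :=
  ([ffun v => g.1 (f.1 v)], [ffun e => g.2 (f.2 e)]).

Definition giso (G H : graph) : bool :=
  [exists f : gmap G H, exists g : gmap H G,
     [&& is_gmorph f, is_gmorph g, gcomp g f == gid G & gcomp f g == gid H]].

(* The disjoint union of X and X^-1: (x, false) is x and (x, true) is x^-1. *)
Definition letter (X : finType) : finType := (X * bool)%type.

Definition linv (X : finType) (a : letter X) : letter X := (a.1, ~~ a.2).

Record lgraph (X : finType) := LGraph {
  underlying :> graph;
  label : edge underlying -> letter X;
  label_einv : forall e, label (einv e) = linv (label e) }.

Definition folded (X : finType) (G : lgraph X) : bool :=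
  [forall e : edge G, forall e' : edge G,
     (origin e == origin e') && (label e == label e') ==> (e == e')].

Definition is_lmorph (X : finType) (G H : lgraph X) (f : gmap G H) : bool :=
  is_gmorph f && [forall e, label (f.2 e) == label e].

Definition Hom (X : finType) (G H : lgraph X) : {set gmap G H} :=
  [set f | is_lmorph f].

Definition liso (X : finType) (G H : lgraph X) : bool :=
  [exists f in Hom G H, exists g in Hom H G,
     (gcomp g f == gid G) && (gcomp f g == gid H)].

Lemma flipK (T : Type) : involutive (fun e : T * bool => (e.1, ~~ e.2)).
Proof. by case=> i b /=; rewrite negbK. Qed.

Lemma flip_neq (T : eqType) (e : T * bool) : (e.1, ~~ e.2) != e.
Proof. by case: e => i [] /=; rewrite xpair_eqE andbF. Qed.

(* Up to isomorphism, the graphs homeomorphic to a compact line segment are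
   the graphs segment k with 0 < k, and the graphs homeomorphic to a circle
   are the graphs circle n with 0 < n.  The edge (i, false) goes from i to
   i + 1 (modulo n in the circle); circle 1 is a single loop. *)
Definition segment (k : nat) : graph :=
  @Graph 'I_k.+1 ('I_k * bool)%type
    (fun e => if e.2 then fintype.lift ord0 e.1 else widen_ord (leqnSn k) e.1)
    (fun e => (e.1, ~~ e.2)) (@flipK _) (@flip_neq _).

Definition circle (n : nat) : graph :=
  @Graph 'I_n ('I_n * bool)%type
    (fun e => if e.2 then ordS e.1 else e.1)
    (fun e => (e.1, ~~ e.2)) (@flipK _) (@flip_neq _).

Definition labeling (X : finType) (G : graph) : Type :=
  {l : {ffun edge G -> letter X} | [forall e, l (einv e) == linv (l e)]}.

HB.instance Definition _ (X : finType) (G : graph) :=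
  Finite.on (labeling X G).

Lemma labeling_einv (X : finType) (G : graph) (l : labeling X G) (e : edge G) :
  val l (einv e) = linv (val l e).
Proof. by apply/eqP; move: e; apply/forallP; exact: valP l. Qed.

Definition labeled (X : finType) (G : graph) (l : labeling X G) : lgraph X :=
  LGraph (labeling_einv l).

Definition folding (X : finType) (G : graph) : Type :=
  {l : labeling X G | folded (labeled l)}.

HB.instance Definition _ (X : finType) (G : graph) := Finite.on (folding X G).

Definition folded_graph (X : finType) (G : graph) (l : folding X G) : lgraph X :=
  labeled (val l).

Section Iso.
Variable X : finType.
Implicit Types G H K : lgraph X.

Lemma gid_Hom G : gid G \in Hom G G.
Proof.
rewrite inE; apply/andP; split; apply/forallP=> e; rewrite !ffunE //.
by rewrite !eqxx.
Qed.

Lemma gcomp_Hom G H K (f : gmap G H) (g : gmap H K) :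
  f \in Hom G H -> g \in Hom H K -> gcomp g f \in Hom G K.
Proof.
rewrite !inE => /andP[/forallP mf /forallP lf] /andP[/forallP mg /forallP lg].
apply/andP; split; apply/forallP=> e; rewrite !ffunE.
  have /andP[/eqP of_ /eqP if_] := mf e.
  by have /andP[/eqP-> /eqP->] := mg (f.2 e); rewrite of_ if_ !eqxx.
by rewrite (eqP (lg _)) (eqP (lf _)).
Qed.

Lemma gcompA (G H K L : graph) (f : gmap G H) (g : gmap H K) (h : gmap K L) :
  gcomp h (gcomp g f) = gcomp (gcomp h g) f.
Proof. by congr (_, _); apply/ffunP=> x; rewrite !ffunE. Qed.

Lemma gcomp1g (G H : graph) (f : gmap G H) : gcomp (gid H) f = f.
Proof. by case: f => f1 f2; congr (_, _); apply/ffunP=> x; rewrite !ffunE. Qed.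

Lemma gcompg1 (G H : graph) (f : gmap G H) : gcomp f (gid G) = f.
Proof. by case: f => f1 f2; congr (_, _); apply/ffunP=> x; rewrite !ffunE. Qed.

Lemma lisoP G H :
  reflect (exists f g, [/\ f \in Hom G H, g \in Hom H G,
                           gcomp g f = gid G & gcomp f g = gid H])
          (liso G H).
Proof.
apply: (iffP exists_inP) => [[f hf /exists_inP[g hg /andP[/eqP? /eqP?]]]|].
  by exists f, g.
case=> f [g [hf hg gf fg]]; exists f => //; apply/exists_inP; exists g => //.
by rewrite gf fg !eqxx.
Qed.

Lemma liso_refl : reflexive (@liso X).
Proof.
move=> G; apply/lisoP; exists (gid G), (gid G).
by split; rewrite ?gid_Hom ?gcomp1g.
Qed.

Lemma liso_sym : symmetric (@liso X).
Proof.
suff H G K : liso G K -> liso K G by move=> G K; apply/idP/idP; apply: H.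
by case/lisoP=> f [g [? ? ? ?]]; apply/lisoP; exists g, f.
Qed.

Lemma liso_trans : transitive (@liso X).
Proof.
move=> H G K /lisoP[f [g [hf hg gf fg]]] /lisoP[f' [g' [hf' hg' gf' fg']]].
apply/lisoP; exists (gcomp f' f), (gcomp g g').
split; rewrite ?(gcomp_Hom hf) ?(gcomp_Hom hg') //.
  by rewrite -gcompA (gcompA f f' g') gf' gcomp1g.
by rewrite -gcompA (gcompA g' g f) fg gcomp1g.
Qed.

Lemma leq_card_Hom G G' H H' : liso G G' -> liso H H' ->
  (#|Hom G H| <= #|Hom G' H'|)%N.
Proof.
move=> /lisoP[f [g [hf hg gf fg]]] /lisoP[f' [g' [hf' hg' gf' fg']]].
have inj : injective (fun h : gmap G H => gcomp f' (gcomp h g)).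
  apply: (@can_inj _ _ _ (fun h => gcomp g' (gcomp h f))) => h.
  by rewrite -!gcompA gf gcompg1 gcompA gf' gcomp1g.
rewrite -(card_imset _ inj); apply/subset_leq_card/subsetP=> _ /imsetP[h hh ->].
exact: gcomp_Hom (gcomp_Hom hg hh) hf'.
Qed.

Lemma card_Hom_liso G G' H H' : liso G G' -> liso H H' ->
  #|Hom G H| = #|Hom G' H'|.
Proof.
move=> iG iH; apply/eqP; rewrite eqn_leq !leq_card_Hom //.
  by rewrite liso_sym.
by rewrite liso_sym.
Qed.

End Iso.

Section UWords.
Variables (X : finType) (k : nat).

Definition uword_eq : rel (folding X (segment k)) :=
  fun u v => liso (folded_graph u) (folded_graph v).

Lemma uword_eq_refl : reflexive uword_eq.
Proof. by move=> u; apply: liso_refl. Qed.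

Lemma uword_eq_sym : symmetric uword_eq.
Proof. by move=> u v; apply: liso_sym. Qed.

Lemma uword_eq_trans : transitive uword_eq.
Proof. by move=> u v w; apply: liso_trans. Qed.

Canonical uword_equiv :=
  EquivRel uword_eq uword_eq_refl uword_eq_sym uword_eq_trans.

Definition uword : Type := {eq_quot uword_eq}.

HB.instance Definition _ := Choice.on uword.
HB.instance Definition _ := EqQuotient.on uword.
HB.instance Definition _ := [Countable of uword by <:%/].
HB.instance Definition _ : isFinite uword := CanIsFinite (@reprK _ uword).

Definition uword_graph (u : uword) : lgraph X := folded_graph (repr u).

End UWords.

Section CyclicWords.
Variable X : finType.

Definition folded_circle : Type := {n : nat & folding X (circle n.+1)}.

HB.instance Definition _ := Choice.on folded_circle.

Definition circle_graph (w : folded_circle) : lgraph X :=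
  folded_graph (tagged w).

Definition cword_eq : rel folded_circle :=
  fun w z => liso (circle_graph w) (circle_graph z).

Lemma cword_eq_refl : reflexive cword_eq.
Proof. by move=> u; apply: liso_refl. Qed.

Lemma cword_eq_sym : symmetric cword_eq.
Proof. by move=> u v; apply: liso_sym. Qed.

Lemma cword_eq_trans : transitive cword_eq.
Proof. by move=> u v w; apply: liso_trans. Qed.

Canonical cword_equiv :=
  EquivRel cword_eq cword_eq_refl cword_eq_sym cword_eq_trans.

Definition cword : Type := {eq_quot cword_eq}.

HB.instance Definition _ := Choice.on cword.
HB.instance Definition _ := EqQuotient.on cword.

Definition cword_graph (w : cword) : lgraph X := circle_graph (repr w).

End CyclicWords.

Section Representation.
Variable X : finType.

Lemma gisoP (G H : graph) :
  reflect (exists f g, [/\ @is_gmorph G H f, @is_gmorph H G g,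
                           gcomp g f = gid G & gcomp f g = gid H])
          (giso G H).
Proof.
apply: (iffP existsP) => [[f /existsP[g /and4P[? ? /eqP? /eqP?]]]|].
  by exists f, g.
case=> f [g [hf hg gf fg]]; exists f; apply/existsP; exists g.
by rewrite hf hg gf fg !eqxx.
Qed.

Lemma folded_liso (G H : lgraph X) : liso G H -> folded H -> folded G.
Proof.
case/lisoP=> f [g [hf _ gf _]] /forallP fH.
apply/forallP=> e; apply/forallP=> e'; apply/implyP=> /andP[/eqP oe /eqP le].
move: hf; rewrite inE => /andP[/forallP mf /forallP lf].
have fK a : g.2 (f.2 a) = a.
  by have /ffunP/(_ a) := congr1 snd gf; rewrite !ffunE.
have /implyP := forallP (fH (f.2 e)) (f.2 e'); move/(_ _)/eqP.
rewrite (eqP (lf e)) (eqP (lf e')) le eqxx andbT.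
have /andP[/eqP-> _] := mf e; have /andP[/eqP-> _] := mf e'.
by rewrite oe => /(_ (eqxx _)) fe; rewrite -(fK e) fe fK.
Qed.

(* Transport of a folded labeling along an isomorphism with G. *)
Lemma folding_of_giso (H : lgraph X) (G : graph) :
  folded H -> giso H G -> exists l : folding X G, liso H (folded_graph l).
Proof.
move=> fH /gisoP[f [g [hf hg gf fg]]].
pose l0 := [ffun e => label (g.2 e)] : {ffun edge G -> letter X}.
have hl0 : [forall e, l0 (einv e) == linv (l0 e)].
  apply/forallP=> e; rewrite !ffunE -label_einv.
  by have /andP[_ /eqP->] := forallP hg e.
pose l : labeling X G := exist _ l0 hl0.
have fK a : g.2 (f.2 a) = a.
  by have /ffunP/(_ a) := congr1 snd gf; rewrite !ffunE.
have iHl : liso H (labeled l).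
  apply/lisoP; exists f, g; split=> //; rewrite inE.
    by rewrite /is_lmorph hf; apply/forallP=> e; rewrite /= ffunE fK.
  by rewrite /is_lmorph hg; apply/forallP=> e; rewrite /= ffunE.
have fl : folded (labeled l) by apply: folded_liso fH; rewrite liso_sym.
by exists (exist _ l fl).
Qed.

Lemma uword_representation (k : nat) (H : lgraph X) :
  folded H -> giso H (segment k) -> exists! u : uword X k, liso H (uword_graph u).
Proof.
move=> fH /(folding_of_giso fH)[l iHl].
have eqr : uword_eq (repr (\pi_(uword X k) l)) l.
  by apply/eqmodP; rewrite reprK.
exists (\pi_(uword X k) l); split=> [|v iHv].
  by apply: liso_trans iHl _; rewrite liso_sym.
rewrite -[v]reprK; apply/eqmodP; apply: liso_trans iHv.
by rewrite liso_sym.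
Qed.

Lemma cword_representation (n : nat) (H : lgraph X) :
  folded H -> (0 < n)%N -> giso H (circle n) ->
  exists! w : cword X, liso H (cword_graph w).
Proof.
move=> fH; case: n => // n _ /(folding_of_giso fH)[l0 iHl].
pose l : folded_circle X := existT (fun n => folding X (circle n.+1)) n l0.
have eqr : cword_eq (repr (\pi_(cword X) l)) l.
  by apply/eqmodP; rewrite reprK.
exists (\pi_(cword X) l); split=> [|v iHv].
  by apply: liso_trans iHl _; rewrite liso_sym.
rewrite -[v]reprK; apply/eqmodP; apply: liso_trans iHv.
by rewrite liso_sym.
Qed.

End Representation.

Definition M (X : finType) (k : nat) := {freeg (uword X k) / int}.

Definition ZC (X : finType) := {freeg (cword X) / int}.

Definition hom_count (X : finType) (k : nat) (w : cword X) : M X k :=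
  \sum_(u : uword X k) << u >> *+ #|Hom (uword_graph u) (cword_graph w)|.

(* fglift extends a function on the basis to a homomorphism. *)
Definition pi_ (X : finType) (k : nat) : ZC X -> M X k :=
  fglift (@hom_count X k).

Lemma pi_is_additive (X : finType) (k : nat) : additive (@pi_ X k).
Proof. exact: lift_is_additive. Qed.

Lemma pi_cword (X : finType) (k : nat) (w : cword X) :
  pi_ k << w >> =
    \sum_(u : uword X k) << u >> *+ #|Hom (uword_graph u) (cword_graph w)|.
Proof. by rewrite /pi_ liftU scale1r. Qed.

(* Main.v *)
From HB Require Import structures.
From mathcomp Require Import all_boot all_order all_algebra.
From mathcomp Require Import generic_quotient.
From mathcomp.multinomials Require Import freeg.
Require Import Defs.

Set Implicit Arguments.
Unset Strict Implicit.
Unset Printing Implicit Defensive.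

Import GRing.Theory.

(** Every vertex of a circle has exactly two edges leaving it.  A morphism from
    a folded segment to a circle cannot turn back, so once it has at least one
    edge there is exactly one way to continue it by one more edge without
    turning back.  Pulling labels back along this continuation produces a
    folded labeling of the longer segment.  Hence, for a labeled segment u with
    k >= 1 edges and a cyclic word w,

      |Hom(u, w)| = sum over the folded l extending u of |Hom(l, w)|,

    where l runs over the labeled segments with k + 1 edges whose first k edges
    carry the labels of u ([card_Hom_extensions]).  The right-hand side is an
    integer combination of the coefficients of pi_(k+1)(w), with coefficients
    that do not depend on w: the u-word v is counted once for every such l in
    its isomorphism class.  The map [restriction] is the homomorphism with
    these coefficients.  Which end of the u-word is
    extended depends on the representative chosen for it, but the argument
    works for any choice.

    The hypothesis 2 <= k enters because a segment without edges has no
    direction to continue: a point of the circle extends to an edge in two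
    ways, and the count above would be off by a factor 2. *)

(** * Locally injective morphisms and labels *)

(** Edges leaving a common vertex have distinct images.  For a morphism from a
    segment this means that the path does not backtrack; unlike foldedness, the
    condition makes sense before labels are chosen. *)
Definition star_injective (G H : graph) (f : gmap G H) :=
  forall e e', origin e = origin e' -> f.2 e = f.2 e' -> e = e'.

Section GraphMorphisms.
Variable X : finType.

Lemma gmorphP (G H : graph) (f : gmap G H) :
  reflect (forall e, origin (f.2 e) = f.1 (origin e)
                     /\ einv (f.2 e) = f.2 (einv e)) (is_gmorph f).
Proof.
apply: (iffP forallP) => h e.
  by have /andP[/eqP ? /eqP ?] := h e.
by have [-> ->] := h e; rewrite !eqxx.
Qed.

Lemma HomP (G H : lgraph X) (f : gmap G H) :
  reflect (is_gmorph f /\ forall e, label (f.2 e) = label e) (f \in Hom G H).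
Proof.
rewrite inE; apply: (iffP andP) => -[hf hl]; split=> //.
  by move=> e; apply/eqP/(forallP hl).
by apply/forallP=> e; apply/eqP.
Qed.

Lemma foldedP (G : lgraph X) :
  reflect (forall e e' : edge G, origin e = origin e' -> label e = label e' ->
             e = e') (folded G).
Proof.
apply: (iffP idP) => [h e e' oe le|h].
  have /implyP := forallP (forallP h e) e'.
  by rewrite oe le !eqxx => /(_ isT)/eqP.
apply/forallP=> e; apply/forallP=> e'; apply/implyP=> /andP[/eqP oe /eqP le].
by apply/eqP/h.
Qed.

Lemma Hom_star_injective (G H : lgraph X) (f : gmap G H) :
  folded G -> f \in Hom G H -> star_injective f.
Proof.
move=> /foldedP fG /HomP[_ lf] e e' oe fe.
by apply: fG => //; rewrite -!lf fe.
Qed.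

(** The labels of the target determine those of the source, so that
    morphisms of unlabeled graphs can be constructed first. *)
Lemma pullback_labeling (G : graph) (H : lgraph X) (f : gmap G H) :
  is_gmorph f -> exists l : labeling X G, f \in Hom (labeled l) H.
Proof.
move=> /[dup] hf /gmorphP mf.
pose l0 := [ffun e => label (f.2 e)] : {ffun edge G -> letter X}.
have hl : [forall e, l0 (einv e) == linv (l0 e)].
  by apply/forallP=> e; rewrite !ffunE -(mf e).2 label_einv.
pose l : labeling X G := exist _ l0 hl.
exists l; apply/HomP; split=> // e.
by rewrite /= ffunE.
Qed.

Lemma star_injective_folded (G H : lgraph X) (f : gmap G H) :
  folded H -> f \in Hom G H -> star_injective f -> folded G.
Proof.
move=> /foldedP fH /HomP[/gmorphP mf lf] inj.
apply/foldedP=> e e' oe le; apply: inj => //.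
apply: fH; last by rewrite !lf.
by rewrite (mf e).1 (mf e').1 oe.
Qed.

End GraphMorphisms.

(** * Continuing a path in a circle *)

Section Circle.
Variable n : nat.
Local Notation C := (circle n.+1).

(** The edge that follows e when the circle is traversed in the direction
    of e. *)
Definition next_edge (e : edge C) : edge C :=
  (if e.2 then ord_pred e.1 else ordS e.1, e.2).

Lemma origin_next (e : edge C) : origin (next_edge e) = origin (einv e).
Proof. by case: e => i [] //=; rewrite ord_predK. Qed.

Lemma next_edge_neq (e : edge C) : next_edge e <> einv e.
Proof. by case: e => i []. Qed.

(** Vertices of a circle have valence 2, so the inverse of e and [next_edge e]
    are all the edges that leave the end of e. *)
Lemma next_edgeP (e e' : edge C) :
  origin e' = origin (einv e) -> e' <> einv e -> e' = next_edge e.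
Proof.
case: e e' => i [] [j []] //=.
- by move=> <- _; rewrite /next_edge /= ordSK.
- by move=> ->.
- by move=> /ordS_inj ->.
- by move=> ->.
Qed.

End Circle.

(** * Morphisms from a segment as edge paths *)

Section Segment.

Definition init (k : nat) : gmap (segment k) (segment k.+1) :=
  ([ffun v => widen_ord (leqnSn _) v],
   [ffun e => (widen_ord (leqnSn _) e.1, e.2)]).

Lemma init_gmorph k : is_gmorph (init k).
Proof.
apply/gmorphP=> -[i b]; rewrite !ffunE /=; split=> //.
by case: b; apply: val_inj.
Qed.

(** The path is indexed by nat, of which only the values below k matter, so
    that it can be prolonged without casts between ordinals.  It is a morphism
    only if consecutive edges match, as [path_map_gmorph] requires. *)
Definition path_map (H : graph) (k : nat) (d : nat -> edge H) :
    gmap (segment k) H :=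
  ([ffun v : 'I_k.+1 => if (v : nat) is i.+1 then origin (einv (d i))
                        else origin (d 0)],
   [ffun e : 'I_k * bool => if e.2 then einv (d e.1) else d e.1]).

Lemma path_map_gmorph (H : graph) (k : nat) (d : nat -> edge H) :
  (forall i, i.+1 < k -> origin (d i.+1) = origin (einv (d i))) ->
  is_gmorph (path_map k d).
Proof.
move=> hd; apply/gmorphP=> -[[i lik] b]; rewrite !ffunE /=.
case: b; rewrite ?einvK /=; split=> //.
by case: i lik => //= i lik; apply: hd.
Qed.

Lemma path_map_star_injective (H : graph) (k : nat) (d : nat -> edge H) :
  (forall i, i.+1 < k -> d i.+1 <> einv (d i)) ->
  star_injective (path_map k d).
Proof.
move=> hd [[i li] b] [[j lj] c] /(congr1 val); rewrite !ffunE /=.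
case: b c => [] [] /=; rewrite /bump /= ?add1n => oe.
- by move=> _; congr (_, _); apply: val_inj; case: oe.
- by move=> /esym dj; case: (hd i); rewrite oe.
- by move=> di; case: (hd j); rewrite -oe.
- by move=> _; congr (_, _); apply: val_inj.
Qed.

Lemma gmorph_segment_eq (H : graph) (k : nat) (f g : gmap (segment k.+1) H) :
  is_gmorph f -> is_gmorph g ->
  (forall i, f.2 (i, false) = g.2 (i, false)) -> f = g.
Proof.
move=> /gmorphP mf /gmorphP mg fg.
have fg2 : f.2 = g.2.
  apply/ffunP=> -[i []] //.
  by rewrite -[(i, true)]/(einv ((i, false) : edge (segment _)))
    -(mf _).2 -(mg _).2 fg.
have fg1 : f.1 = g.1.
  apply/ffunP=> v; have [e <-] : exists e : edge (segment k.+1), origin e = v.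
    case: (unliftP ord0 v) => [i|] ->; first by exists (i, true).
    by exists (ord0, false); apply: val_inj.
  by rewrite -(mf e).1 -(mg e).1 fg2.
by case: f g fg1 fg2 {mf mg fg} => ? ? [? ?] /= -> ->.
Qed.

End Segment.

(** * Unique extension by one edge *)

Section Extension.
Variables n k : nat.
Local Notation C := (circle n.+1).
Local Notation S := (segment k.+1).
Local Notation S' := (segment k.+2).

Lemma gmorph_last_edge (g : gmap S' C) :
  is_gmorph g -> star_injective g ->
  g.2 (ord_max, false) = next_edge (g.2 (widen_ord (leqnSn _) ord_max, false)).
Proof.
move=> /gmorphP mg inj.
pose e : edge S' := (widen_ord (leqnSn _) ord_max, false).
have oe : origin ((ord_max, false) : edge S') = origin (einv e).
  exact: val_inj.
apply: next_edgeP.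
  by rewrite (mg (ord_max, false)).1 (mg e).2 (mg (einv e)).1 oe.
by rewrite (mg e).2 => /(inj _ _ oe).
Qed.

(** A non-backtracking path of positive length leaves a single choice for the
    edge that follows, so it has at most one extension. *)
Lemma gcomp_init_inj (g h : gmap S' C) :
  is_gmorph g -> is_gmorph h -> star_injective g -> star_injective h ->
  gcomp g (init k.+1) = gcomp h (init k.+1) -> g = h.
Proof.
move=> mg mh ig ih gh.
have e_gh (i : 'I_k.+1) : g.2 (widen_ord (leqnSn _) i, false) =
                          h.2 (widen_ord (leqnSn _) i, false).
  by have /ffunP/(_ (i, false)) := congr1 snd gh; rewrite !ffunE.
apply: gmorph_segment_eq => // i.
case: (unliftP ord_max i) => [j|] ->; last first.
  by rewrite !gmorph_last_edge // e_gh.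
have -> : fintype.lift ord_max j = widen_ord (leqnSn _) j.
  by apply: val_inj; apply: lift_max.
exact: e_gh.
Qed.

Lemma gmorph_extend (f : gmap S C) :
  is_gmorph f -> star_injective f ->
  exists g : gmap S' C,
    [/\ is_gmorph g, star_injective g & gcomp g (init k.+1) = f].
Proof.
move=> /[dup] hf /gmorphP mf inj.
(* The edges of f, followed by the one that goes on in the same direction. *)
pose d i := if i <= k then f.2 (inord i, false)
            else next_edge (f.2 (ord_max, false)).
have od i : i.+1 < k.+1 ->
    origin ((inord i.+1, false) : edge S) =
    origin (einv ((inord i, false) : edge S)).
  move=> li; apply: val_inj; rewrite /= /bump /= add1n !inordK //.
  exact: ltnW.
have dmax : d k = f.2 (ord_max, false).
  by rewrite /d leqnn; congr (f.2 (_, _)); apply: val_inj; rewrite /= inordK.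
have oS i : i.+1 < k.+2 -> origin (d i.+1) = origin (einv (d i)).
  rewrite ltnS leq_eqVlt => /predU1P[[->]|li].
    by rewrite dmax /d ltnn origin_next.
  rewrite /d ifT // ifT; last by rewrite ltnW.
  by rewrite (mf (_, _)).1 (mf (_, _)).2 (mf (einv _)).1 od.
have nS i : i.+1 < k.+2 -> d i.+1 <> einv (d i).
  rewrite ltnS leq_eqVlt => /predU1P[[->]|li].
    by rewrite dmax /d ltnn; apply: next_edge_neq.
  rewrite /d ifT // ifT; last by rewrite ltnW.
  by rewrite (mf (_, _)).2 => /(inj _ _ (od _ li)).
exists (path_map k.+2 d); split.
- exact: path_map_gmorph.
- exact: path_map_star_injective.
have mg : is_gmorph (gcomp (path_map k.+2 d) (init k.+1)).
  apply/gmorphP=> e; have /gmorphP mp := path_map_gmorph oS.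
  have /gmorphP mi := init_gmorph k.+1.
  by rewrite ![(gcomp _ _).1 _]ffunE ![(gcomp _ _).2 _]ffunE
     (mp _).1 (mp _).2 (mi _).1 (mi _).2.
apply: gmorph_segment_eq => // i.
rewrite !ffunE /= /d -ltnS ltn_ord; congr (f.2 (_, _)).
by apply: val_inj; rewrite /= inordK.
Qed.

End Extension.

(** * Counting morphisms by extensions *)

Section Count.
Variables (X : finType) (k : nat).

(** Restriction to the first k + 1 edges is a bijection from the pairs (l, g),
    with l extending u and g a morphism from l to w, onto the morphisms from
    u to w.  Injectivity: g is determined by its restriction, and l is then
    read off from w along g.  Surjectivity: extend the underlying path and pull
    the labels back, which gives a folded labeling because w is folded and the
    path does not backtrack. *)
Lemma card_Hom_extensions n (u : folding X (segment k.+1))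
    (w : folding X (circle n.+1)) :
  #|Hom (folded_graph u) (folded_graph w)| =
  \sum_(l : folding X (segment k.+2) |
        init k.+1 \in Hom (folded_graph u) (folded_graph l))
     #|Hom (folded_graph l) (folded_graph w)|.
Proof.
pose S := [set lg : folding X (segment k.+2) * gmap (segment k.+2) (circle n.+1)
          | (init k.+1 \in Hom (folded_graph u) (folded_graph lg.1))
          & (lg.2 \in Hom (folded_graph lg.1) (folded_graph w))].
pose r (lg : folding X (segment k.+2) * gmap (segment k.+2) (circle n.+1)) :=
  gcomp lg.2 (init k.+1).
have inS l g : ((l, g) \in S) =
    (init k.+1 \in Hom (folded_graph u) (folded_graph l)) &&
    (g \in Hom (folded_graph l) (folded_graph w)) by rewrite inE.
transitivity #|S|.
  have r_inj : {in S &, injective r}.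
    move=> [l g] [m h]; rewrite !inS => /andP[_ hg] /andP[_ hh] gh.
    have /HomP[mg lg] := hg; have /HomP[mh lh] := hh.
    have {}gh : g = h.
      apply: gcomp_init_inj gh => //.
        exact: Hom_star_injective (valP l) hg.
      exact: Hom_star_injective (valP m) hh.
    congr (_, _) => //; apply/val_inj/val_inj/ffunP=> e.
    by rewrite [LHS](esym (lg e)) [RHS](esym (lh e)) gh.
  rewrite -(card_in_imset r_inj); apply: eq_card => f.
  apply/idP/imsetP=> [hf|[[l g]]]; last first.
    by rewrite inS => /andP[hi hg] ->; apply: gcomp_Hom hi hg.
  have /HomP[mf lf] := hf.
  have [g [mg ig gf]] := gmorph_extend mf (Hom_star_injective (valP u) hf).
  have [l hg] := @pullback_labeling X _ (folded_graph w) g mg.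
  have fl := star_injective_folded (valP w) hg ig.
  exists (exist _ l fl, g); last by rewrite /r gf.
  rewrite inS hg andbT.
  apply/HomP; split=> [|e]; first exact: init_gmorph.
  have /HomP[_ lg] := hg.
  by rewrite -(lf e) -gf [in RHS]ffunE lg.
(* The inner index type must not mention l for the iterated sum to become a
   sum over pairs. *)
pose H (l : folding X (segment k.+2)) :
  {set gmap (segment k.+2) (circle n.+1)} :=
  Hom (folded_graph l) (folded_graph w).
under [RHS]eq_bigr => l _ do rewrite -[#|_|]/#|H l| -sum1_card.
by rewrite pair_big_dep -sum1_card; apply: eq_bigl => -[l g]; exact: inS.
Qed.

End Count.

(** * The homomorphism between the free modules *)

HB.instance Definition _ (X : finType) (k : nat) :=
  GRing.isZmodMorphism.Build (ZC X) (M X k) (@pi_ X k) (@pi_is_additive X k).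

Section Reduction.
Local Open Scope ring_scope.
Variables (X : finType) (k : nat).

(** The number of ways to orient v so that it begins with the chosen
    representative of u; this is the matrix of [restriction]. *)
Definition extension_count (v : uword X k.+1) (u : uword X k) : nat :=
  #|[set l : folding X (segment k.+1) |
      (\pi_(uword X k.+1)%qT l == v)
      && (init k \in Hom (uword_graph u) (folded_graph l))]|.

Definition restriction : M X k.+1 -> M X k :=
  fglift (fun v => \sum_(u : uword X k) << u >> *+ extension_count v u).

HB.instance Definition _ :=
  GRing.isZmodMorphism.Build (M X k.+1) (M X k) restriction
    (lift_is_additive _).

Lemma restrictionU v :
  restriction << v >> = \sum_(u : uword X k) << u >> *+ extension_count v u.
Proof. by rewrite /restriction liftU scale1r. Qed.

End Reduction.

Lemma freeg_eq_on_basis (K : choiceType) (V : zmodType)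
    (f g : {additive {freeg K / int} -> V}) :
  (forall x, f << x >> = g << x >>)%R -> f =1 g.
Proof.
move=> fg; elim/freeg_ind_dom0 => [|c x D _ _ IH]; first by rewrite !raddf0.
by rewrite !raddfD IH -[c]intz -freegU_mulz !raddfMz fg.
Qed.

Lemma liso_uword_graph (X : finType) (k : nat) (l : folding X (segment k)) :
  liso (folded_graph l) (uword_graph (\pi_(uword X k)%qT l)).
Proof.
suff : uword_eq l (repr (\pi_(uword X k)%qT l)) by [].
by apply/eqmodP; rewrite reprK.
Qed.

(** Comparing coefficients of u, this is [card_Hom_extensions] with the
    labelings l grouped by isomorphism class. *)
Lemma restriction_pi (X : finType) (k : nat) (w : cword X) :
  restriction (pi_ k.+2 << w >>%R) = pi_ k.+1 << w >>%R.
Proof.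
rewrite !pi_cword raddf_sum /=.
under eq_bigr => v _ do rewrite raddfMn /= restrictionU -sumrMnl.
rewrite exchange_big /=; apply: eq_bigr => u _.
under eq_bigr => v _ do rewrite -mulrnA.
rewrite sumrMnr; congr (_ *+ _)%R.
rewrite [RHS]card_Hom_extensions.
rewrite (partition_big (\pi_(uword X k.+2)%qT) predT) //=.
apply: eq_bigr => v _.
rewrite -sum_nat_const; symmetry.
under eq_bigl => l do rewrite andbC -in_set.
apply: eq_big => [l|l]; rewrite ?inE // => /andP[/eqP <- _].
exact: card_Hom_liso (liso_uword_graph l) (liso_refl (cword_graph w)).
Qed.

Theorem theorem2 (X : finType) (k : nat) (hk : (2 <= k)%N) :
  exists p : {additive M X k -> M X k.-1}, p \o pi_ k =1 pi_ k.-1.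
Proof.
case: k hk => [|[|k]] // _.
exists (restriction (X := X) (k := k.+1)).
apply: (@freeg_eq_on_basis _ _ (@restriction X k.+1 \o pi_ k.+2) (pi_ k.+1)) => w.
exact: restriction_pi.
Qed.
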